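(* If a smooth class $(K,\leq)$ (in a countable relational language) is $1$-local and has fAP, then $(K,\leq)$ has $\leq$-EPPA.
   Context: All languages are countable and relational. Smooth class. A pair $(K,\leq)$ is a smooth class in the language $\mathcal{L}$ if $K$ is a class of finite $\mathcal{L}$-structures closed under isomorphism and $\leq$ is a binary relation on $K$ such that: (1) $\leq$ is transitive and $A\leq B$ implies $A\subseteq B$ (substructure); (2) for every $B\in K$ and every enumeration $\overline{b}=(b_1,\dots,b_n)$ of $B$ there is a (possibly infinite) set $\Phi_{\overline{b}}(\overline{x})$, $|\overline{x}|=n$, of universal $\mathcal{L}$-formulas containing the atomic diagram of $B$ (w.r.t. $\overline{b}$) such that for all $C\in K$ with $B\subseteq C$: $B\leq C\Leftrightarrow C\models\Phi_{\overline{b}}(\overline{b})$; (3) if $f:A\to B$ is an isomorphism of members of $K$ and $\overline{a}$ enumerates $A$, then $\Phi_{\overline{a}}=\Phi_{f(\overline{a})}$; (4) $\emptyset\in K$ and $\emptyset\leq A$ for all $A\in K$. fAP (free amalgamation). For $A,B,C\in K$ with $A\subseteq B,C$ (and $B\cap C=A$), $C*_AB$ is the structure with universe $B\cup C$ whose relations are exactly those of $B$ and those of $C$. $(K,\leq)$ has fAP if whenever $A\leq B$ and $A\leq C$, then $C*_AB\in K$ and $B,C\leq C*_AB$. Smooth intersections. For all $A,B,C\in K$ (substructures of a common structure), $A\leq B$ implies $A\cap C\leq B\cap C$. 1-local. $(K,\leq)$ is $1$-local if $K$ is closed under substructure, $(K,\leq)$ has smooth intersections, and for all $A,C\subseteq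 B$ in $K$: $A\leq B$ and $C\leq B$ imply $A\cup C\leq B$. $\leq$-EPPA. $(K,\leq)$ has $\leq$-EPPA if for any $A\in K$ and any partial automorphisms $f_1,\dots,f_n$ of $A$ (isomorphisms between substructures of $A$) with $\mathrm{dom}(f_i)\leq A$ and $\mathrm{range}(f_i)\leq A$ for each $i$, there exist $B\in K$ with $A\leq B$ and automorphisms $g_1,\dots,g_n$ of $B$ with $f_i\subseteq g_i$ for each $i$. *)

(* Defs.v *)
From mathcomp Require Import all_boot.
From mathcomp Require Import finmap.

Set Implicit Arguments.
Unset Strict Implicit.
Unset Printing Implicit Defensive.

Local Open Scope fset_scope.

(* Smooth classes of finite relational structures.

   Finite structures have as universe a finite subset of an ambient type [U],
   so that substructure, intersection, union and free amalgam are the literal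
   set-theoretic notions.  [U] is meant to be infinite (see [infinite_ambient]):
   every finite structure then has an isomorphic copy inside [U], and a class
   closed under isomorphism is determined by its members inside [U]. *)

Record language := Language {
  symbol : countType;
  arity : symbol -> nat }.

Definition infinite_ambient (U : choiceType) : Prop :=
  forall X : {fset U}, exists x : U, x \notin X.

Section Structures.
Context {L : language} {U : choiceType}.

Record structure := Structure {
  dom : {fset U};
  rel : forall R : symbol L, {fset (arity R).-tuple U};
  rel_dom : forall (R : symbol L) (t : (arity R).-tuple U),
    t \in rel R -> {subset t <= dom} }.

Implicit Types A B C D E M : structure.

Definition substr A B : Prop :=
  dom A `<=` dom B /\
  forall (R : symbol L) (t : (arity R).-tuple U),
    t \in rel A R <-> t \in rel B R /\ {subset t <= dom A}.

(* Only the restriction of [f : U -> U] to [dom A] matters. *)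
Definition isom (f : U -> U) A B : Prop :=
  [/\ {in dom A &, injective f},
      f @` dom A = dom B
    & forall (R : symbol L) (t : (arity R).-tuple U), {subset t <= dom A} ->
        t \in rel A R <-> [tuple of map f t] \in rel B R].

Lemma capstr_dom A C (R : symbol L) (t : (arity R).-tuple U) :
  t \in rel A R `&` rel C R -> {subset t <= dom A `&` dom C}.
Proof.
by case/fsetIP=> /rel_dom tA /rel_dom tC x xt; rewrite inE tA // tC.
Qed.

(* For substructures of a common structure this is the substructure induced on
   [dom A `&` dom C]. *)
Definition capstr A C : structure := Structure (@capstr_dom A C).

Lemma restr_dom B (X : {fset U}) (R : symbol L) (t : (arity R).-tuple U) :
  t \in [fset t in rel B R | all (mem X) t] -> {subset t <= dom B `&` X}.
Proof.
rewrite !inE => /andP[/rel_dom tB /allP tX] x xt.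
by rewrite inE tB //; apply: tX.
Qed.

(* The substructure of [B] induced on [dom B `&` X]. *)
Definition restr B (X : {fset U}) : structure := Structure (@restr_dom B X).

Lemma amalg_dom B C (R : symbol L) (t : (arity R).-tuple U) :
  t \in rel B R `|` rel C R -> {subset t <= dom B `|` dom C}.
Proof.
by case/fsetUP=> /rel_dom tD x xt; rewrite inE tD // orbT.
Qed.

(* [C *_A B], when [A] is a substructure of [B] and [C] with universe
   [dom B `&` dom C]. *)
Definition free_amalgam B C : structure := Structure (@amalg_dom B C).

(* Formulas with free variables among x_0, ..., x_(n-1). *)
Inductive atom (n : nat) : Type :=
  | AEq (i j : 'I_n)
  | ARel (R : symbol L) (v : (arity R).-tuple 'I_n).

Inductive qfformula (n : nat) : Type :=
  | QAtom (a : atom n)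
  | QNot (q : qfformula n)
  | QAnd (q r : qfformula n)
  | QOr (q r : qfformula n).

(* [UAll] binds the variable 0 of its argument and shifts the others. *)
Inductive uformula : nat -> Type :=
  | UQf n (q : qfformula n) : uformula n
  | UAll n (p : uformula n.+1) : uformula n.

Definition asat C n (e : n.-tuple U) (a : atom n) : Prop :=
  match a with
  | AEq i j => tnth e i = tnth e j
  | ARel R v => [tuple of map (tnth e) v] \in rel C R
  end.

Fixpoint qsat C n (e : n.-tuple U) (q : qfformula n) : Prop :=
  match q with
  | QAtom a => asat C e a
  | QNot q => ~ qsat C e q
  | QAnd q r => qsat C e q /\ qsat C e r
  | QOr q r => qsat C e q \/ qsat C e r
  end.

Fixpoint usat C n (p : uformula n) : n.-tuple U -> Prop :=
  match p in uformula n return n.-tuple U -> Prop with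
  | UQf _ q => fun e => qsat C e q
  | UAll _ p => fun e => forall x : U, x \in dom C -> usat C p [tuple of x :: e]
  end.

Definition enumerates n (b : n.-tuple U) B : Prop := uniq b /\ b =i dom B.

Definition contains_diagram B n (b : n.-tuple U) (Phi : uformula n -> Prop) :
  Prop :=
  forall a : atom n,
    (asat B b a -> Phi (UQf (QAtom a))) /\
    (~ asat B b a -> Phi (UQf (QNot (QAtom a)))).

Record smooth_class (K : structure -> Prop) (le : structure -> structure -> Prop)
    : Prop := SmoothClass {
  smooth_isom : forall f A B, isom f A B -> K A -> K B;
  smooth_rel : forall A B, le A B -> K A /\ K B;
  smooth_trans : forall A B C, le A B -> le B C -> le A C;
  smooth_substr : forall A B, le A B -> substr A B;
  smooth_universal :
    exists Phi : forall B n, n.-tuple U -> uformula n -> Prop,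
      (forall B n (b : n.-tuple U), K B -> enumerates b B ->
         contains_diagram B b (Phi B n b) /\
         forall C, K C -> substr B C ->
           le B C <-> (forall p : uformula n, Phi B n b p -> usat C p b)) /\
      (forall f A B n (a : n.-tuple U), K A -> K B -> isom f A B ->
         enumerates a A ->
         forall p : uformula n, Phi A n a p <-> Phi B n [tuple of map f a] p);
  smooth_empty : exists E, dom E = fset0 /\ K E /\ forall A, K A -> le E A }.

Section Properties.
Variables (K : structure -> Prop) (le : structure -> structure -> Prop).

Definition fAP : Prop :=
  forall A B C, le A B -> le A C -> dom B `&` dom C = dom A ->
    [/\ K (free_amalgam B C), le B (free_amalgam B C)
      & le C (free_amalgam B C)].

Definition smooth_intersections : Prop :=
  forall A B C, K A -> K B -> K C ->
    (exists M, [/\ substr A M, substr B M & substr C M]) ->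
    le A B -> le (capstr A C) (capstr B C).

Definition one_local : Prop :=
  [/\ forall A B, K B -> substr A B -> K A,
      smooth_intersections
    & forall A B C, K A -> K B -> K C -> substr A B -> substr C B ->
        le A B -> le C B -> le (restr B (dom A `|` dom C)) B].

(* The partial map f_i is [f i] restricted to [dom (D i)], with range [E i]. *)
Definition le_EPPA : Prop :=
  forall A (n : nat) (f : 'I_n -> U -> U) (D E : 'I_n -> structure),
    K A ->
    (forall i, [/\ substr (D i) A, substr (E i) A, isom (f i) (D i) (E i),
                   le (D i) A & le (E i) A]) ->
    exists B, [/\ K B, le A B
      & exists g : 'I_n -> U -> U,
          forall i, isom (g i) B B /\ {in dom (D i), f i =1 g i}].

End Properties.
End Structures.

Arguments structure : clear implicits.

(* Main.v *)
From mathcomp Require Import all_boot all_fingroup all_algebra finmap.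
From mathcomp Require Import boolp.
Require Import Defs.

Set Implicit Arguments.
Unset Strict Implicit.
Unset Printing Implicit Defensive.

(** Call a set [S] closed in [A] when the substructure on [S] is [<= A].
    Smooth intersections make closed sets stable under intersection, so every
    point [x] of [A] has a least closed set [cl x] around it; 1-locality makes
    them stable under union, so a set is closed as soon as it contains [cl x]
    for each of its points [x].  Thus [<=] is governed by a unary closure
    operator, and the partial automorphisms of the statement are the partial
    isomorphisms between closed sets; they commute with [cl].

    The structure [B] is a union of finitely many translates of [A] under a
    finite group [G] acting on the ambient set, and three properties of the
    action are needed.

    - Extension: each partial isomorphism between closed sets of [A] is
      induced by some [g] in [G].
    - Consistency: if [g] maps points of [A] into [A], it respects on them the
      relations of [A] and the operator [cl].  Hence relations and closures
      can be transported from [A] to all its translates without conflict.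
    - Conformality: a finite set stable under the transported closures, any two
      points of which lie in a common translate of [A], lies in one translate.

    Given such an action ([ambient_closure_cover]), one shows by induction on
    the size of [M] that every [M] in [B] stable under the transported
    closures spans a member of [K] in which every smaller stable set is closed
    ([copies_closed_le]).  If the points of [M] are pairwise in common
    translates, [M] lies in a translate, where this holds because [A] is in
    [K].  Otherwise some [u] and [v] in [M] lie in no common translate.  The
    points of [M] whose closure omits [u], and those whose closure omits [v],
    form two smaller stable sets; a closure, or a related tuple, is contained
    in one translate, so it cannot involve both [u] and [v], and [M] is the
    free amalgam of the two parts.  The free amalgamation property finishes
    this case, and for [M := B] one gets that [B] is in [K] and [A <= B].

    The action is built in three layers over the finite set [X] of points of
    [A].

    - Extension and consistency for invariants of tuples
      ([wgroup_extend], [wgroup_color]).  A new point is a point of [X]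
      together with a weight, in a finite abelian group, for every tuple and
      every position of it; a tuple of new points has as total the sum of the
      weights that its points give to the tuple below them.  The points of [X]
      are embedded so that totals are the prescribed colors, and the group is
      the group of all permutations preserving totals.  A partial color
      preserving injection extends: a tuple not inside its domain has an entry
      outside, whose weight can absorb any defect.
    - Conformality ([generic_extend], [conformal]).  A bad set is one not
      contained in a translate.  A new point carries a label for each bad set
      [s] through it, out of [#|s| - 1] labels, and points of a translate
      carry distinct labels at [s].  By the pigeonhole principle a set of
      points with pairwise distinct labels does not cover any bad set.
    - Closures ([finite_closure_cover]).  A point is paired with a translate of
      the closure of a point below it, which makes its closure in the union of
      the copies unambiguous. *)

Lemma perm_extend (T : finType) (D : {set T}) (f : T -> T) :
  {in D &, injective f} -> exists p : {perm T}, {in D, p =1 f}.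
Proof.
have [n] := ubnP #|D|; elim: n D => // n IH D.
have [->|[x xD]] := set_0Vmem D; first by exists 1%g => y; rewrite inE.
rewrite (cardsD1 x) xD ltnS => /IH{}IH finj.
have [|p pE] := IH.
  by move=> a b /setD1P[_ aD] /setD1P[_ bD]; apply: finj.
exists (p * tperm (p x) (f x))%g => y yD; rewrite permM.
have [->|yx] := eqVneq y x; first by rewrite tpermL.
have pyE : p y = f y by apply: pE; rewrite !inE yx.
rewrite tpermD // ?(inj_eq perm_inj) 1?eq_sym // pyE.
by apply: contra yx => /eqP/finj ->.
Qed.

(** * Extending color-preserving partial injections *)

Section WeightedPoints.
Local Open Scope ring_scope.
Import GRing.Theory.
Variables (X J : finType) (j0 : J) (V : finZmodType) (c : {ffun J -> X} -> V).

(** A weight is attached to a tuple and to a position in it, so that a tuple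
    with repeated entries needs no special treatment. *)
Definition weighted := (X * {ffun {ffun J -> X} * J -> V})%type.

(** The whole color of a tuple is put at the position [j0], whichever point
    stands there. *)
Definition base_weight : {ffun {ffun J -> X} * J -> V} :=
  [ffun w => if w.2 == j0 then c w.1 else 0].

Definition wembed (x : X) : weighted := (x, base_weight).

(** The sum of the weights that the points of [y] give, at their own position,
    to the tuple of [X] that lies below [y]. *)
Definition total (y : J -> weighted) : V :=
  \sum_j (y j).2 ([ffun k => (y k).1], j).

Definition wgroup : {set {perm weighted}} :=
  [set g : {perm weighted} | [forall y : {ffun J -> weighted},
     total (fun j => g (y j)) == total y]].

Lemma wgroupP (g : {perm weighted}) :
  reflect (forall y : J -> weighted, total (fun j => g (y j)) = total y)
    (g \in wgroup).
Proof.
rewrite inE; apply: (iffP forallP) => gP y; last exact/eqP/gP.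
have yE : fun_of_fin [ffun j => y j] = y by apply: funext => j; rewrite ffunE.
by have /eqP := gP [ffun j => y j]; rewrite yE.
Qed.

Lemma wgroup_group_set : group_set wgroup.
Proof.
apply/group_setP; split=> [|g h /wgroupP gP /wgroupP hP]; apply/wgroupP => y.
  by congr (total _); apply/funext => j; rewrite perm1.
by rewrite -[RHS]gP -[RHS]hP; congr (total _); apply: funext => j; rewrite permM.
Qed.
Canonical wgroup_group := Group wgroup_group_set.

Lemma total_wembed (u : {ffun J -> X}) : total (fun j => wembed (u j)) = c u.
Proof.
rewrite /total (bigD1 j0) //= big1 => [|j /negPf jj0]; rewrite ffunE /= ?jj0 //.
by rewrite eqxx addr0; congr c; apply/ffunP => j; rewrite ffunE.
Qed.

Lemma wgroup_color (g : {perm weighted}) (u u' : {ffun J -> X}) :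
  g \in wgroup -> (forall j, g (wembed (u j)) = wembed (u' j)) -> c u = c u'.
Proof.
move=> /wgroupP gP guu'; rewrite -!total_wembed -gP.
by congr (total _); apply: funext => j; rewrite guu'.
Qed.

(** Extend [f] to a permutation [p] of [X] and act by [p] on tuples, correcting
    weights.  A point of [D] must receive the correction [d] that carries the
    base weights to themselves.  On a tuple with entries outside [D], the first
    position found outside compensates for all the corrections made at the
    positions inside; on a tuple inside [D] the corrections already add up to
    the difference of two equal colors.  So totals do not change. *)
Lemma wgroup_extend (D : {set X}) (f : X -> X) :
  {in D &, injective f} ->
  (forall u : {ffun J -> X}, (forall j, u j \in D) ->
     c [ffun j => f (u j)] = c u) ->
  exists2 g, g \in wgroup & forall x, x \in D -> g (wembed x) = wembed (f x).
Proof.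
move=> finj cf; have [p pf] := perm_extend finj.
pose mv (q : {perm X}) (u : {ffun J -> X}) := [ffun j => q (u j)].
have mvK (q : {perm X}) u : mv q (mv q^-1 u)%g = u.
  by apply/ffunP => j; rewrite !ffunE permKV.
have mvVK (q : {perm X}) u : (mv q^-1 (mv q u))%g = u.
  by apply/ffunP => j; rewrite !ffunE permK.
pose d u j := base_weight (mv p u, j) - base_weight (u, j).
pose pivot (u : {ffun J -> X}) := [pick j | u j \notin D].
pose corr u j x := if x \in D then d u j else
  if pivot u == Some j then - (\sum_(k | u k \in D) d u k) else 0.
have sum_corr u : \sum_j corr u j (u j) = 0.
  rewrite (bigID (fun j => u j \in D)) /=.
  under eq_bigr => j uj do rewrite /corr uj.
  under [X in _ + X]eq_bigr => j uj do rewrite /corr (negPf uj).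
  rewrite /pivot; case: pickP => [j1 uj1|uD].
    rewrite addrC (bigD1 j1) //= eqxx [X in _ + X + _]big1 ?addr0 ?addNr //.
    move=> j /andP[_ jj1].
    by rewrite -(inj_eq Some_inj) eq_sym in jj1; rewrite (negPf jj1).
  have {}uD j : u j \in D by have /negbFE := uD j.
  rewrite [X in _ + X]big_pred0 ?addr0 => [|j]; last by rewrite uD.
  rewrite (eq_bigl xpredT) => [|j]; last by rewrite uD.
  rewrite sumrB (bigD1 j0) //= big1 ?addr0 => [|j /negPf jj0]; last first.
    by rewrite ffunE /= jj0.
  rewrite (bigD1 j0) //= big1 ?addr0 => [|j /negPf jj0]; last first.
    by rewrite ffunE /= jj0.
  rewrite !ffunE /= eqxx -(cf u uD); apply/eqP; rewrite subr_eq0; apply/eqP.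
  by congr c; apply/ffunP => j; rewrite !ffunE pf.
pose g0 (z : weighted) : weighted :=
  (p z.1, [ffun w => z.2 (mv p^-1%g w.1, w.2) + corr (mv p^-1%g w.1) w.2 z.1]).
have g0_inj : injective g0.
  move=> [x chi] [x' chi'] /= [/perm_inj<- chiE]; congr (_, _).
  apply/ffunP => -[u j]; move/ffunP/(_ (mv p u, j)): chiE; rewrite !ffunE /=.
  by rewrite mvVK => /addIr.
exists (perm g0_inj) => [|x xD]; last first.
  rewrite permE /g0 /= pf //; congr (_, _); apply/ffunP => -[w j].
  by rewrite ffunE /= /corr xD /d mvK addrC subrK.
apply/wgroupP => y; rewrite /total -[RHS]addr0.
rewrite -[X in _ + X](sum_corr [ffun k => (y k).1]) -big_split /=.
apply: eq_bigr => j _; rewrite permE /= [LHS]ffunE /=.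
have -> : mv p^-1%g [ffun k => ((perm g0_inj) (y k)).1] = [ffun k => (y k).1].
  by apply/ffunP => k; rewrite !ffunE permE /= permK.
by rewrite [[ffun k => (y k).1] j]ffunE.
Qed.
End WeightedPoints.

(** * Labels that make copies conformal *)

Section Conformal.
Variables (X Y : finType) (e : X -> Y) (e_inj : injective e).
Variable G : {group {perm Y}}.
Implicit Type s : {set Y}.

Definition in_copy (s : {set Y}) : bool :=
  [exists g in G, g @: s \subset codom e].

(** Membership of [s] in a translate of [e @: X], with the group element
    applied to [s] rather than to the copy. *)
Lemma in_copyP s :
  reflect (exists2 g, g \in G & forall y, y \in s -> exists x, g y = e x)
    (in_copy s).
Proof.
apply: (iffP exists_inP) => -[g gG sP]; exists g => //.
  by move=> y ys; apply/codomP; rewrite (subsetP sP) ?imset_f.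
by apply/subsetP => _ /imsetP[y /sP[x ->] ->]; apply: codom_f.
Qed.

Lemma in_copy_perm g s : g \in G -> in_copy (g @: s) = in_copy s.
Proof.
move=> gG; apply/in_copyP/in_copyP => -[h hG sP].
  exists (g * h)%g => [|y ys]; first exact: groupM.
  by rewrite permM; apply: sP; apply: imset_f.
exists (g^-1 * h)%g => [|_ /imsetP[y ys ->]]; first by rewrite groupM ?groupV.
by rewrite permM permK; apply: sP.
Qed.

Definition labelled := (Y * {ffun {set Y} -> 'I_#|Y|.+1})%type.

(** Where no label is called for, the label must be [ord_max]: this makes the
    irrelevant part of a point rigid.  Relevant labels never reach [ord_max],
    whose value is [#|Y|], since they stay below [#|s| - 1]. *)
Definition label_ok (z : labelled) : bool :=
  [forall s : {set Y}, if ~~ in_copy s && (z.1 \in s)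
                       then z.2 s < #|s|.-1 else z.2 s == ord_max].

(** The third clause makes generic sets project injectively to [Y]. *)
Definition generic (z z' : labelled) : bool :=
  [&& label_ok z, label_ok z', (z.1 == z'.1) ==> (z == z') &
   [forall s : {set Y}, [&& ~~ in_copy s, z.1 \in s, z'.1 \in s & z.1 != z'.1]
      ==> (z.2 s != z'.2 s)]].

(** A bad set [s] is not contained in the copy of [X], so the positions of its
    points within [s :&: e @: X] stay below [#|s| - 1]. *)
Definition cembed (x : X) : labelled :=
  (e x, [ffun s : {set Y} => if ~~ in_copy s && (e x \in s)
    then inord (index (e x) (enum (s :&: [set y in codom e]))) else ord_max]).

Definition cgroup : {set {perm labelled}} :=
  [set g : {perm labelled} | [exists h in G, forall z : labelled, (g z).1 == h z.1] &
           [forall z, forall z', generic z z' ==> generic (g z) (g z')]].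

Lemma cgroupP (g : {perm labelled}) :
  reflect ((exists2 h, h \in G & forall z, (g z).1 = h z.1) /\
           forall z z', generic z z' -> generic (g z) (g z'))
    (g \in cgroup).
Proof.
rewrite inE; apply: (iffP andP).
  move=> [/exists_inP[h hG /forallP gh] /forallP gg].
  split; first by exists h => // z; apply/eqP.
  by move=> z z' zz'; move/forallP/(_ z')/implyP: (gg z); apply.
move=> [[h hG gh] gg]; split.
  by apply/exists_inP; exists h => //; apply/forallP => z; apply/eqP.
by apply/forallP => z; apply/forallP => z'; apply/implyP/gg.
Qed.

Lemma cgroup_group_set : group_set cgroup.
Proof.
apply/group_setP; split.
  apply/cgroupP; split=> [|z z']; last by rewrite !perm1.
  by exists 1%g => // z; rewrite !perm1.
move=> g g' /cgroupP[[h hG gh] gg] /cgroupP[[h' h'G gh'] gg'].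
apply/cgroupP; split=> [|z z' zz']; last by rewrite !permM; apply/gg'/gg.
by exists (h * h')%g => [|z]; rewrite ?groupM // !permM gh' gh.
Qed.
Canonical cgroup_group := Group cgroup_group_set.

Lemma cembed_inj : injective cembed.
Proof. by move=> x x' [/e_inj]. Qed.

Lemma card_bad s : ~~ in_copy s -> #|s :&: [set y in codom e]| < #|s|.
Proof.
move=> bad; apply: proper_card; rewrite properE subsetIl /=.
apply: contra bad => /subsetP sI; apply/in_copyP; exists 1%g => // y /sI.
by rewrite !inE perm1 => /andP[_ /codomP].
Qed.

Lemma cembed_label x s : ~~ in_copy s -> e x \in s ->
  (cembed x).2 s = index (e x) (enum (s :&: [set y in codom e])) :> nat
  /\ (cembed x).2 s < #|s|.-1.
Proof.
move=> bad xs; rewrite ffunE bad xs /=.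
have lt_i : index (e x) (enum (s :&: [set y in codom e])) < #|s|.-1.
  have := card_bad bad; case: #|s| => // n; rewrite ltnS; apply: leq_trans.
  by rewrite cardE index_mem mem_enum !inE xs codom_f.
rewrite inordK //; apply: leq_trans lt_i _.
by rewrite (leq_trans (leq_pred _)) // ltnW // ltnS max_card.
Qed.

Lemma cembed_generic x x' : generic (cembed x) (cembed x').
Proof.
have ok y : label_ok (cembed y).
  apply/forallP => s; case: ifP => [/andP[bad ys]|ys].
    by have [] := cembed_label bad ys.
  by rewrite ffunE ys.
rewrite /generic !ok /=; apply/andP; split.
  by apply/implyP => /eqP/e_inj ->.
apply/forallP => s; apply/implyP => /and4P[bad xs x's]; apply: contra => /eqP lE.
have [l1 _] := cembed_label bad xs; have [l2 _] := cembed_label bad x's.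
have: index (e x) (enum (s :&: [set y in codom e])) =
      index (e x') (enum (s :&: [set y in codom e])) by rewrite -l1 -l2 lE.
by move=> /(index_inj (e x)) ->; rewrite // mem_enum !inE ?xs ?x's codom_f.
Qed.

(** Above [h], relabel each bad set by a permutation of the labels.  Two points
    of [M] on the same bad set [s] have different labels there, and so have
    their intended images at [h @: s]; the intended relabelling is therefore a
    partial injection among the labels below [#|s| - 1].  It is extended by the
    identity on the remaining labels, hence to a permutation that preserves both
    kinds. *)
Lemma generic_extend (M : {set labelled}) h :
  {in M &, forall z z', generic z z'} -> h \in G ->
  (forall z, z \in M -> exists x, h z.1 = e x) ->
  exists2 g, g \in cgroup &
    forall z x, z \in M -> h z.1 = e x -> g z = cembed x.
Proof.
move=> Mg hG MX.
pose F (z : labelled) : labelled := odflt z (omap cembed [pick x | h z.1 == e x]).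
have FE z x : z \in M -> h z.1 = e x -> F z = cembed x.
  move=> zM hz; rewrite /F; case: pickP => [x' /eqP|/(_ x)]; last by rewrite hz eqxx.
  by rewrite hz => /e_inj <-.
(* Fixing all labels from [#|s|.-1] on forces the others to be permuted. *)
have sigmaP s : exists sg : {perm 'I_#|Y|.+1},
    (forall k : 'I_#|Y|.+1, ~~ (k < #|s|.-1) -> sg k = k) /\
    if in_copy s then sg = 1%g else
    forall z : labelled, z \in M -> z.1 \in s -> sg (z.2 s) = (F z).2 (h @: s).
  have [_|bad] := boolP (in_copy s).
    by exists 1%g; split=> // k _; rewrite perm1.
  pose P (k : 'I_#|Y|.+1) (z : labelled) := [&& z \in M, z.1 \in s & z.2 s == k].
  pose f k := if [pick z | P k z] is Some z then (F z).2 (h @: s) else k.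
  have hbad : ~~ in_copy (h @: s) by rewrite in_copy_perm.
  have Mlab (z : labelled) : z \in M -> z.1 \in s -> z.2 s < #|s|.-1.
    move=> zM zs; have /and4P[/forallP/(_ s)] := Mg z z zM zM.
    by rewrite bad zs.
  have Fs (z : labelled) : z \in M -> z.1 \in s -> (F z).1 = h z.1 /\ (F z).1 \in h @: s.
    move=> zM zs; have [x hx] := MX z zM; rewrite (FE z x) //= -hx.
    by rewrite imset_f.
  have Flab (z : labelled) : z \in M -> z.1 \in s -> (F z).2 (h @: s) < #|s|.-1.
    move=> zM zs; have [x hx] := MX z zM; rewrite (FE z x) //=.
    have [] := @cembed_label x _ hbad; first by rewrite -hx imset_f.
    by rewrite card_imset //; apply: perm_inj.
  have fE (z : labelled) : z \in M -> z.1 \in s -> f (z.2 s) = (F z).2 (h @: s).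
    move=> zM zs; rewrite /f; case: pickP => [z'|/(_ z)]; last first.
      by rewrite /P zM zs eqxx.
    move=> /and3P[z'M z's /eqP lE]; congr ((F _).2 _).
    have /and4P[_ _ /implyP zz' /forallP/(_ s)] := Mg z' z z'M zM.
    rewrite bad zs z's /= => /implyP zz2.
    have [/eqP|/zz2] := eqVneq z'.1 z.1; first by move/zz'/eqP.
    by rewrite lE eqxx.
  pose D := [set k | [exists z, P k z]] :|: [set k : 'I_#|Y|.+1 | ~~ (k < #|s|.-1)].
  have DP (k : 'I_#|Y|.+1) : k \in D ->
      (exists z, [/\ z \in M, z.1 \in s & z.2 s = k]) \/ ~~ (k < #|s|.-1).
    rewrite !inE => /orP[/existsP[z /and3P[? ? /eqP ?]]|]; last by right.
    by left; exists z.
  have foff (k : 'I_#|Y|.+1) : ~~ (k < #|s|.-1) -> f k = k.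
    move=> kN; rewrite /f; case: pickP => // z /and3P[zM zs /eqP zk].
    by rewrite -zk Mlab in kN.
  have f_inj : {in D &, injective f}.
    move=> k k' /DP[[z [zM zs <-]]|kN] /DP[[z' [z'M z's <-]]|k'N] //.
    - rewrite !fE // => FF; have [zz|zz] := eqVneq z.1 z'.1.
        by have /and4P[_ _ /implyP zz' _] := Mg z z' zM z'M; move/eqP/zz'/eqP: zz => ->.
      have [x hx] := MX z zM; have [x' hx'] := MX z' z'M.
      rewrite (FE z x) // (FE z' x') // in FF.
      have /and4P[_ _ _ /forallP/(_ (h @: s))/implyP gg] := cembed_generic x x'.
      have /negP[] : (cembed x).2 (h @: s) != (cembed x').2 (h @: s).
        by apply: gg; rewrite hbad /= -hx -hx' !imset_f // (inj_eq perm_inj).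
      by rewrite FF.
    - by rewrite fE // (foff k') // => kE; rewrite -kE Flab in k'N.
    - by rewrite fE // (foff k) // => kE; rewrite kE Flab in kN.
    - by rewrite !foff.
  have [sg sgE] := perm_extend f_inj.
  exists sg; split=> [k kN|z zM zs]; last first.
    rewrite sgE ?fE // inE; apply/orP; left; rewrite inE.
    by apply/existsP; exists z; rewrite /P zM zs eqxx.
  by rewrite sgE ?foff // !inE kN orbT.
have [sg sgP] := choice sigmaP.
pose g0 (z : labelled) : labelled :=
  (h z.1, [ffun s : {set Y} => sg (h^-1%g @: s) (z.2 (h^-1%g @: s))]).
have hK (s : {set Y}) : h @: (h^-1%g @: s) = s.
  by rewrite -imset_comp; under eq_imset do rewrite /= permKV; rewrite imset_id.
have hVK (s : {set Y}) : h^-1%g @: (h @: s) = s.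
  by rewrite -imset_comp; under eq_imset do rewrite /= permK; rewrite imset_id.
have g0_inj : injective g0.
  move=> [y l] [y' l'] [/perm_inj-> lE]; congr (_, _); apply/ffunP => s.
  by move/ffunP/(_ (h @: s)): lE; rewrite !ffunE hVK => /perm_inj.
have g0E (z : labelled) s : (g0 z).2 (h @: s) = sg s (z.2 s) by rewrite ffunE hVK.
have ok_max (z : labelled) s :
    label_ok z -> ~~ (~~ in_copy s && (z.1 \in s)) -> z.2 s = ord_max.
  by move=> /forallP/(_ s); case: ifP => // _ /eqP.
have sg_max s : sg s ord_max = ord_max.
  have [fixs _] := sgP s; apply: fixs; rewrite -leqNgt /=.
  by rewrite (leq_trans (leq_pred _)) // max_card.
have g0_ok z : label_ok z -> label_ok (g0 z).
  move=> zok; apply/forallP => s'; rewrite -(hK s'); move: (h^-1%g @: s') => s.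
  rewrite in_copy_perm // g0E /= (mem_imset _ _ perm_inj).
  rewrite card_imset; last exact: perm_inj.
  move/forallP/(_ s): (zok); case: ifP => [_ lt_z|zs /eqP->]; last by rewrite sg_max.
  rewrite ltnNge; apply/negP => le_sg.
  have [fixs _] := sgP s; have: sg s (sg s (z.2 s)) = sg s (z.2 s).
    by rewrite fixs // -leqNgt.
  by move/perm_inj => sgz; rewrite sgz leqNgt lt_z in le_sg.
have g0_gen z z' : generic z z' -> generic (g0 z) (g0 z').
  move=> /and4P[zok z'ok /implyP zz' /forallP gen].
  rewrite /generic !g0_ok //=; apply/andP; split.
    by apply/implyP; rewrite (inj_eq perm_inj) => /zz'/eqP->.
  apply/forallP => s'; rewrite -(hK s'); move: (h^-1%g @: s') => s.
  rewrite in_copy_perm // ![(g0 _).2 _]g0E !(mem_imset _ _ perm_inj).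
  by rewrite !(inj_eq perm_inj); apply: gen.
exists (perm g0_inj) => [|z x zM hz].
  apply/cgroupP; split; first by exists h => // z; rewrite permE.
  by move=> z z' /g0_gen; rewrite !permE.
rewrite permE -(FE z x) //; have Fz1 : (F z).1 = h z.1 by rewrite (FE z x).
have okF : label_ok (F z).
  by rewrite (FE z x) //; have /and4P[] := cembed_generic x x.
have okz : label_ok z by have /and4P[] := Mg z z zM zM.
apply/eqP; rewrite -pair_eqE /pair_eq /= -Fz1 eqxx /=; apply/eqP/ffunP => s'.
rewrite -(hK s'); move: (h^-1%g @: s') => s; rewrite -/(g0 z).2 g0E.
have [zs|zs] := boolP (~~ in_copy s && (z.1 \in s)).
  have /andP[bad zs1] := zs; have [_] := sgP s.
  by rewrite (negPf bad); apply.
rewrite !ok_max ?sg_max // in_copy_perm // Fz1 (mem_imset _ _ perm_inj).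
exact: zs.
Qed.

Lemma cembed_extend (D : {set X}) (f : X -> X) h :
  h \in G -> (forall x, x \in D -> h (e x) = e (f x)) ->
  exists2 g, g \in cgroup & forall x, x \in D -> g (cembed x) = cembed (f x).
Proof.
move=> hG hf.
have [||g gG gE] := @generic_extend (cembed @: D) h _ hG.
- by move=> _ _ /imsetP[x _ ->] /imsetP[x' _ ->]; apply: cembed_generic.
- by move=> _ /imsetP[x xD ->]; exists (f x); apply: hf.
by exists g => // x xD; apply: gE; [apply: imset_f | apply: hf].
Qed.

Lemma cgroup_project g x x' : g \in cgroup -> g (cembed x) = cembed x' ->
  exists2 h, h \in G & forall u u' : X, g (cembed u) = cembed u' -> h (e u) = e u'.
Proof.
move=> /cgroupP[[h hG gh] _] gx; exists h => // u u' gu.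
by rewrite -[e u]/(cembed u).1 -gh gu.
Qed.

(** Genericity is preserved by the group and holds within the copy of [X], so
    pairwise linked points are generic.  Their projection [s] cannot be bad,
    since its points would carry [#|s|] distinct labels below [#|s| - 1]; it is
    thus moved into the copy, and [generic_extend] lifts this motion. *)
Lemma conformal (M : {set labelled}) :
  {in M &, forall z z', exists g x x',
     [/\ g \in cgroup, g z = cembed x & g z' = cembed x']} ->
  exists2 g, g \in cgroup & forall z, z \in M -> exists x, g z = cembed x.
Proof.
move=> linked.
have Mg : {in M &, forall z z', generic z z'}.
  move=> z z' zM z'M; have [g [x [x' [gG gz gz']]]] := linked z z' zM z'M.
  have := groupVr gG => /cgroupP[_ /(_ _ _ (cembed_generic x x'))].
  by rewrite -gz -gz' !permK.
have [/in_copyP[h hG hM]|bad] := boolP (in_copy [set z.1 | z in M]).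
  have hM' z : z \in M -> exists x, h z.1 = e x by move=> zM; apply/hM/imset_f.
  have [g gG gE] := generic_extend Mg hG hM'.
  by exists g => // z zM; have [x hx] := hM' z zM; exists x; apply: gE.
set s := [set z.1 | z in M] in bad.
have inj1 : {in M &, injective (fun z : labelled => z.1)}.
  move=> z z' zM z'M zz; have /and4P[_ _ /implyP zE _] := Mg z z' zM z'M.
  by apply/eqP/zE; rewrite zz.
have inj2 : {in M &, injective (fun z : labelled => z.2 s)}.
  move=> z z' zM z'M zz; have /and4P[_ _ _ /forallP/(_ s)] := Mg z z' zM z'M.
  by rewrite bad !imset_f // zz eqxx /= implybF negbK => /eqP/(inj1 _ _ zM z'M).
have cs : #|s| = #|M| by rewrite card_in_imset.
have: #|[set (z : labelled).2 s | z in M]| <= #|[set k : 'I_#|Y|.+1 | k < #|s|.-1]|.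
  apply/subset_leq_card/subsetP => _ /imsetP[w wM ->]; rewrite inE.
  have /and4P[/forallP/(_ s) w_ok _ _ _] := Mg w w wM wM.
  by rewrite bad imset_f in w_ok.
rewrite (card_in_imset inj2) -cs.
have le_s : #|[set k : 'I_#|Y|.+1 | k < #|s|.-1]| <= #|s|.-1.
  rewrite cardE -(size_map val) -{2}(size_iota 0 #|s|.-1).
  apply: uniq_leq_size => [|k /mapP[k' + ->]].
    by rewrite map_inj_uniq ?enum_uniq //; apply: val_inj.
  by rewrite mem_enum inE mem_iota.
move=> /leq_trans/(_ le_s).
case: (posnP #|s|) => [/eqP|s0]; last by rewrite leqNgt prednK ?leqnn.
rewrite cards_eq0 => /eqP s0; case/negP: bad; rewrite s0; apply/in_copyP.
by exists 1%g => // y; rewrite inE.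
Qed.
End Conformal.

(** The two layers put together; colors are coded in a cyclic group. *)
Lemma conformal_extension (X J T : finType) (j0 : J) (c : {ffun J -> X} -> T) :
  exists (Y : finType) (e : X -> Y) (G : {group {perm Y}}),
  [/\ injective e,
      forall (D : {set X}) (f : X -> X), {in D &, injective f} ->
        (forall u : {ffun J -> X}, (forall j, u j \in D) ->
           c [ffun j => f (u j)] = c u) ->
        exists2 g, g \in G & forall x, x \in D -> g (e x) = e (f x),
      forall g (u u' : {ffun J -> X}), g \in G ->
        (forall j, g (e (u j)) = e (u' j)) -> c u = c u'
    & forall M : {set Y},
        {in M &, forall z z', exists g x x',
           [/\ g \in G, g z = e x & g z' = e x']} ->
        exists2 g, g \in G & forall z, z \in M -> exists x, g z = e x].
Proof.
pose code (t : T) : 'I_#|T|.+1 := inord (enum_rank t).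
have code_inj : injective code.
  move=> t t' /(congr1 (@nat_of_ord _)); rewrite !inordK ?ltnS; last first.
  - by rewrite ltnW.
  - by rewrite ltnW.
  by move/val_inj/enum_rank_inj.
pose e0 := @wembed X J j0 'I_#|T|.+1 (code \o c).
have e0_inj : injective e0 by move=> x x' [].
pose G0 := [group of wgroup X J 'I_#|T|.+1].
exists (labelled (weighted X J 'I_#|T|.+1)), (cembed e0 G0), (cgroup_group e0 G0).
split.
- exact: cembed_inj.
- move=> D f finj fc.
  have [u uD|h hG hf] := @wgroup_extend X J j0 _ (code \o c) D f finj.
    by rewrite /= fc.
  exact: cembed_extend hG hf.
- move=> g u u' gG gu.
  have [h hG hu] := cgroup_project gG (gu j0).
  apply: code_inj; apply: (@wgroup_color X J j0 _ (code \o c) h) => // j.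
  exact/hu/gu.
- exact: conformal.
Qed.

(** * Covers compatible with a closure operator *)

Section ClosureCover.
Variables (X : finType) (cl : X -> {set X}) (I : Type) (Q : I -> seq X -> Prop).

(** The requirements on the action, stated for an arbitrary type [Z] so that
    they can be transported from a finite type to the ambient type.  The
    relations are given as predicates [Q] on sequences of points. *)
Record closure_cover (Z : Type) (e : X -> Z) (gT : finGroupType)
    (G : {group gT}) (act : gT -> Z -> Z) : Prop := ClosureCover {
  cover_inj : injective e;
  cover_act1 : forall z, act 1%g z = z;
  cover_actM : forall g h z, act (g * h)%g z = act h (act g z);
  cover_extend : forall (D : {set X}) (f : X -> X), {in D &, injective f} ->
    (forall x, x \in D -> cl x \subset D /\ f @: cl x = cl (f x)) ->
    (forall i t, {subset t <= D} -> (Q i (map f t) <-> Q i t)) ->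
    exists2 g, g \in G & forall x, x \in D -> act g (e x) = e (f x);
  cover_cl : forall g x x' y, g \in G -> act g (e x) = e x' -> y \in cl x ->
    exists2 y', y' \in cl x' & act g (e y) = e y';
  cover_rel : forall g i t t', g \in G ->
    map (act g \o e) t = map e t' -> (Q i t <-> Q i t');
  cover_conformal : forall M : Z -> Prop,
    (forall z z', M z -> M z' -> exists g x x',
       [/\ g \in G, act g z = e x & act g z' = e x']) ->
    (forall g x y, g \in G -> M (act g (e x)) -> y \in cl x ->
       M (act g (e y))) ->
    exists2 g, g \in G & forall z, M z -> exists x, act g z = e x }.

Hypothesis cl_trans : forall x y, y \in cl x -> cl y \subset cl x.

(** The color of a tuple records which relations hold between its entries, which
    entries lie in the closure of which, and the sizes of the closures.  Points
    are then pairs [(g x, g (cl x))].  Sizes serve in the last step: a linked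
    set that is stable under closures projects into a copy of [X], and the
    translate [k (cl x')] of a closure found there is contained in the closure
    [cl x] of the copy, hence equal to it. *)
Lemma finite_closure_cover : exists (Z : finType) (e : X -> Z)
  (gT : finGroupType) (G : {group gT}) (act : gT -> Z -> Z),
  closure_cover e G act.
Proof.
pose J := option X.
pose data (u : {ffun J -> X}) :=
  (fun i (w : seq J) => Q i (map u w), fun j k => u j \in cl (u k),
   fun k => #|cl (u k)|).
pose c u := [set u' | `[< data u = data u' >]].
have c_data u u' : c u = c u' -> data u = data u'.
  by move/setP/(_ u'); rewrite !inE => cE; apply/asboolP; rewrite cE; apply/asboolP.
have [Y [e [G [e_inj e_ext e_data e_conf]]]] := @conformal_extension X J _ None c.
pose S g := [set x | [exists x', g (e x) == e x']].
(* Tuples of arbitrary length reduce to the single tuple [u] that lists all the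
   points of [X] kept in the copy by [g], padded with [x0]. *)
have transfer g x0 x0' : g \in G -> g (e x0) = e x0' ->
    exists p : X -> X, [/\ forall x x', g (e x) = e x' -> p x = x',
      forall t, {subset t <= S g} -> forall i, Q i t <-> Q i (map p t) &
      {in S g &, forall x y, (y \in cl x) = (p y \in cl (p x)) /\
         #|cl x| = #|cl (p x)|}].
  move=> gG gx0; pose p x := odflt x0' [pick x' | g (e x) == e x'].
  have pE x x' : g (e x) = e x' -> p x = x'.
    rewrite /p => gx; case: pickP => [y /eqP|/(_ x')]; last by rewrite gx eqxx.
    by rewrite gx => /e_inj.
  have pS x : x \in S g -> g (e x) = e (p x).
    by rewrite inE => /existsP[x' /eqP gx]; rewrite gx (pE x x').
  have x0S : x0 \in S g by rewrite inE; apply/existsP; exists x0'; rewrite gx0.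
  pose u : {ffun J -> X} := [ffun j => if j is Some x then
    if x \in S g then x else x0 else x0].
  have uS j : u j \in S g by rewrite ffunE; case: j => // x; case: ifP.
  have uE x : x \in S g -> u (Some x) = x by rewrite ffunE => ->.
  pose u' := [ffun j => p (u j)].
  have u'E x : x \in S g -> u' (Some x) = p x by move=> xS; rewrite ffunE uE.
  have [dQ dcl dcard] : data u = data u'.
    by apply/c_data/(e_data g) => // j; rewrite [in RHS]ffunE; apply: pS.
  exists p; split=> // [t tS i|x y xS yS]; last first.
    split.
      by have := congr1 (fun F => F (Some y) (Some x)) dcl; rewrite !uE ?u'E.
    by have := congr1 (fun F => F (Some x)) dcard; rewrite !uE ?u'E.
  have := congr1 (fun F => F i (map Some t)) dQ.
  rewrite -!map_comp.
  have -> : map (u \o Some) t = t.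
    by rewrite -[RHS]map_id; apply/eq_in_map => x /tS xS /=; rewrite uE.
  have -> : map (u' \o Some) t = map p t.
    by apply/eq_in_map => x /tS xS /=; rewrite u'E.
  by move=> ->.
have SP g x x' : g (e x) = e x' -> x \in S g.
  by move=> gx; rewrite inE; apply/existsP; exists x'; rewrite gx.
have mem_clE g x x' y y' : g \in G -> g (e x) = e x' -> g (e y) = e y' ->
    (y \in cl x) = (y' \in cl x').
  move=> gG gx gy; have [p [pE _ pS]] := transfer g x x' gG gx.
  by have [-> _] := pS x y (SP _ _ _ gx) (SP _ _ _ gy); rewrite (pE _ _ gx) (pE _ _ gy).
have card_clE g x x' : g \in G -> g (e x) = e x' -> #|cl x| = #|cl x'|.
  move=> gG gx; have [p [pE _ pS]] := transfer g x x' gG gx.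
  by have [_ ->] := pS x x (SP _ _ _ gx) (SP _ _ _ gx); rewrite (pE _ _ gx).
pose act (g : {perm Y}) (z : Y * {set Y}) := (g z.1, g @: z.2).
pose e1 x := (e x, e @: cl x).
have act1 z : act 1%g z = z.
  case: z => y s; rewrite /act /= perm1; congr (_, _).
  by under eq_imset do rewrite perm1; rewrite imset_id.
have actM g h z : act (g * h)%g z = act h (act g z).
  rewrite /act /= permM -imset_comp; congr (_, _).
  by apply: eq_imset => y; rewrite permM.
have actK g z : act g^-1%g (act g z) = z by rewrite -actM mulgV act1.
have act_cl g x x' y : g \in G -> act g (e1 x) = e1 x' -> y \in cl x ->
    exists2 y', y' \in cl x' & g (e y) = e y'.
  move=> gG [gx gcl] ycl; have: g (e y) \in e @: cl x'.
    by rewrite -gcl !imset_f.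
  by move=> /imsetP[y' y'cl ->]; exists y'.
exists (Y * {set Y})%type, e1, {perm Y}, G, act; split=> //.
- by move=> x x' [/e_inj].
- move=> D f finj fcl fQ.
  have [u uD|g gG gE] := e_ext D f finj.
    have dE : data [ffun j => f (u j)] = data u.
      congr (_, _, _).
      - apply: funext => i; apply: funext => w; apply: propext.
        have -> : map [ffun j => f (u j)] w = map f (map u w).
          by rewrite -map_comp; apply: eq_map => j; rewrite ffunE.
        by apply: fQ => _ /mapP[j _ ->].
      - apply: funext => j; apply: funext => k; rewrite !ffunE.
        have [clD <-] := fcl _ (uD k).
        apply/imsetP/idP => [[y ycl /finj->]|] //; last by exists (u j).
        exact: (subsetP clD).
      apply: funext => k; rewrite !ffunE; have [clD <-] := fcl _ (uD k).
      rewrite card_in_imset // => x y xcl ycl.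
      by apply: finj; apply: (subsetP clD).
    by rewrite /c dE.
  exists g => // x xD; rewrite /act /e1 /= gE //; congr (_, _).
  have [clD <-] := fcl _ xD; rewrite -!imset_comp; apply: eq_in_imset => y ycl /=.
  by rewrite gE // (subsetP clD).
- move=> g x x' y gG gx ycl; have [y' y'cl gy] := act_cl _ _ _ _ gG gx ycl.
  exists y' => //; rewrite /act /e1 /= gy; congr (_, _).
  apply/setP => v; apply/imsetP/imsetP => -[w].
    move=> /imsetP[d dcl ->] ->.
    have dx : d \in cl x by apply: (subsetP (cl_trans ycl)).
    have [d' _ gd] := act_cl _ _ _ _ gG gx dx.
    by exists d' => //; rewrite -(mem_clE g y y' d d').
  move=> d'cl ->; have d'x : w \in cl x' by apply: (subsetP (cl_trans y'cl)).
  have gx' : act g^-1%g (e1 x') = e1 x by rewrite -gx actK.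
  have [d dx gd] := act_cl _ _ _ _ (groupVr gG) gx' d'x.
  have gd' : g (e d) = e w by rewrite -gd permKV.
  by exists (e d) => //; apply: imset_f; rewrite (mem_clE g y y' d w).
- move=> g i [|x t] [|x' t'] gG //= [gx _ gt].
  have [p [pE pQ _]] := transfer g x x' gG gx.
  have ptE : map p t = t'.
    elim: t t' gt {pQ} => [|y t IH] [|y' t'] //= [gy _ /IH ->].
    by rewrite (pE _ _ gy).
  rewrite (pQ (x :: t)) /= ?(pE _ _ gx) ?ptE // => y.
  rewrite inE => /orP[/eqP->|yt]; first exact: SP gx.
  elim: t t' gt yt {pQ ptE} => [|z t IH] [|z' t'] //= [gz _ /IH{}IH].
  by rewrite inE => /orP[/eqP->|//]; apply: SP gz.
move=> M linked closed.
have [z z' /imsetP[v /[!inE] /asboolP Mv ->] /imsetP[v' /[!inE] /asboolP Mv' ->]|g gG gM] :=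
    e_conf [set z.1 | z in [set z : Y * {set Y} | `[< M z >]]].
  have [g [x [x' [gG gv gv']]]] := linked v v' Mv Mv'.
  exists g, x, x'; split=> //; first by case: gv.
  by case: gv'.
have {}gM z : M z -> exists x, g z.1 = e x.
  by move=> Mz; apply/gM/imset_f; rewrite inE; apply/asboolP.
exists g => // z Mz; have [x gx] := gM z Mz; exists x.
have [h [x' [_ [hG hz _]]]] := linked z z Mz Mz.
have zE : z = act h^-1%g (e1 x') by rewrite -hz actK.
pose k := (h^-1 * g)%g.
have kG : k \in G by rewrite groupM ?groupV.
have kx : k (e x') = e x by rewrite permM -gx zE.
suff kcl : k @: (e @: cl x') = e @: cl x.
  by rewrite zE -actM -/k /act /= kx kcl.
apply/eqP; rewrite eqEcard; apply/andP; split.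
  apply/subsetP => _ /imsetP[_ /imsetP[y ycl ->] ->].
  have My : M (act h^-1%g (e1 y)).
    by apply: (closed _ x') => //; rewrite ?groupV // -zE.
  have [y' gy'] := gM _ My.
  have ky : k (e y) = e y' by rewrite permM.
  by rewrite ky; apply: imset_f; rewrite -(mem_clE k x' x y y').
by rewrite (card_imset _ (@perm_inj _ k)) !(card_imset _ e_inj) (card_clE k x' x).
Qed.
End ClosureCover.

Local Open Scope fset_scope.

(** * Realizing a cover inside an infinite set *)

Lemma fresh_injection (U : choiceType) (Z : finType) (A : {fset U}) :
  infinite_ambient U -> exists k : Z -> U, injective k /\ forall z, k z \notin A.
Proof.
move=> infU.
have fresh n : exists s : seq U, [/\ size s = n, uniq s & {in s, forall u, u \notin A}].
  elim: n => [|n [s [sn us sA]]]; first by exists [::].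
  have [u] := infU (A `|` [fset v in s]).
  rewrite !inE negb_or => /andP[uA us'].
  exists (u :: s); split; rewrite /= ?sn ?us' //.
  by move=> v; rewrite inE => /orP[/eqP->|/sA].
have [s [sn us sA]] := fresh #|Z|.
have [u _] := infU A.
have lt_s (z : Z) : enum_rank z < size s by rewrite sn; apply: ltn_ord.
exists (fun z : Z => nth u s (enum_rank z)); split=> [z z' /eqP|z].
  by rewrite nth_uniq ?lt_s // => /eqP/val_inj/enum_rank_inj.
by apply/sA/mem_nth.
Qed.

(** Points of the cover outside [A] are sent to fresh elements of [U], and the
    group fixes all elements of [U] that are not points of the cover. *)
Lemma ambient_closure_cover (U : choiceType) (A : {fset U})
    (cl : A -> {set A}) (I : Type) (Q : I -> seq A -> Prop) :
  infinite_ambient U ->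
  (forall x y, y \in cl x -> cl y \subset cl x) ->
  exists (gT : finGroupType) (G : {group gT}) (act : gT -> U -> U),
    closure_cover cl Q (@fsval U A) G act.
Proof.
move=> infU cl_trans.
have [Z [e [gT [G [act cover]]]]] := @finite_closure_cover _ cl I Q cl_trans.
have e_inj := cover_inj cover.
have [k [k_inj kA]] := fresh_injection Z A infU.
pose h z := if [pick x | e x == z] is Some x then fsval x else k z.
have hE x : h (e x) = fsval x.
  by rewrite /h; case: pickP => [x' /eqP/e_inj-> //|/(_ x)]; rewrite eqxx.
have h_inj : injective h.
  move=> z z'; rewrite /h; case: pickP => [x /eqP<-|_]; case: pickP => [x' /eqP<-|_].
  - by move/val_inj->.
  - by move=> kE; have := kA z'; rewrite -kE fsvalP.
  - by move=> kE; have := kA z; rewrite kE fsvalP.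
  - exact: k_inj.
pose act' g u := if [pick z | h z == u] is Some z then h (act g z) else u.
have act'E g z : act' g (h z) = h (act g z).
  by rewrite /act'; case: pickP => [z' /eqP/h_inj-> //|/(_ z)]; rewrite eqxx.
have act'N g u : (forall z, h z <> u) -> act' g u = u.
  by move=> uN; rewrite /act'; case: pickP => // z /eqP /uN.
have imP u : (exists z, h z = u) \/ (forall z, h z <> u).
  have [|uN] := pselect (exists z, h z = u); first by left.
  by right=> z hz; apply: uN; exists z.
have act'e g x x' : act' g (fsval x) = fsval x' <-> act g (e x) = e x'.
  by rewrite -!hE act'E; split=> [/h_inj|->].
exists gT, G, act'; split.
- exact: val_inj.
- move=> u; have [[z <-]|uN] := imP u; last exact: act'N.
  by rewrite act'E (cover_act1 cover).
- move=> g g' u; have [[z <-]|uN] := imP u; last by rewrite !act'N.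
  by rewrite !act'E (cover_actM cover).
- move=> D f finj fcl fQ; have [g gG gf] := cover_extend cover finj fcl fQ.
  by exists g => // x xD; apply/act'e/gf.
- move=> g x x' y gG /act'e gx ycl.
  by have [y' y'cl gy] := cover_cl cover gG gx ycl; exists y' => //; apply/act'e.
- move=> g i t t' gG gt; have gt' : map (act g \o e) t = map e t'.
    elim: t t' gt => [|x t IH] [|x' t'] //= [gx /IH->].
    by congr (_ :: _); apply/act'e.
  exact: (@cover_rel _ _ _ _ _ _ _ _ _ cover g i t t' gG gt').
move=> M linked closed.
have [||g gG gM] := cover_conformal cover (M := M \o h).
- move=> z z' Mz Mz'; have [g [x [x' [gG gx gx']]]] := linked _ _ Mz Mz'.
  by exists g, x, x'; split=> //; apply: h_inj; rewrite -act'E hE.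
- move=> g x y gG Mx ycl; rewrite /= -act'E hE.
  by apply: (closed _ x) => //; rewrite -hE act'E.
exists g => // u Mu; have [[z zu]|uN] := imP u.
  by rewrite -zu in Mu *; have [x gx] := gM z Mu; exists x; rewrite act'E gx hE.
have [g' [x [_ [_ gu _]]]] := linked u u Mu Mu.
by rewrite act'N // in gu; case: (uN (e x)); rewrite hE.
Qed.

(** * Restrictions and isomorphisms of structures *)

Section Structures.
Context {L : language} {U : choiceType}.
Implicit Types (A B C M : structure L U) (S T : {fset U}).

Lemma structure_ext A B : dom A = dom B ->
  (forall R : symbol L, rel A R =i rel B R) -> A = B.
Proof.
case: A B => [dA rA pA] [dB rB pB] /= dAB rAB; rewrite -dAB in pB *.
have rE : rA = rB by apply: functional_extensionality_dep => R; apply/fsetP/rAB.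
by rewrite -rE in pB *; congr Structure; apply: Prop_irrelevance.
Qed.

Lemma mem_restr B S (R : symbol L) (t : (arity R).-tuple U) :
  (t \in rel (restr B S) R) = (t \in rel B R) && all (mem S) t.
Proof. by rewrite !inE. Qed.

Lemma subset_all (n : nat) (t : n.-tuple U) S : all (mem S) t <-> {subset t <= S}.
Proof. by split=> [/allP|?]; last exact/allP. Qed.

Lemma restr_substr B S : substr (restr B S) B.
Proof.
split=> [|R t]; first exact: fsubsetIl.
rewrite mem_restr; split=> [/andP[tB /allP tS]|[tB tS]].
  by split=> // x xt; rewrite /= inE (rel_dom tB xt); apply: tS.
by rewrite tB; apply/allP => x /tS; rewrite inE => /andP[].
Qed.

Lemma substr_restr A B : substr A B -> A = restr B (dom A).
Proof.
case=> AB rAB; apply: structure_ext => [|R t].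
  by apply/esym/fsetIidPr.
rewrite mem_restr; apply/idP/andP => [/rAB[-> /subset_all]|[tB /subset_all tA]] //.
exact/rAB.
Qed.

Lemma restr_restr B S T : restr (restr B S) T = restr B (S `&` T).
Proof.
apply: structure_ext => [|R t]; first by rewrite /= fsetIA.
rewrite !mem_restr -andbA -all_predI; congr (_ && _).
by apply: eq_all => x /=; rewrite inE.
Qed.

Lemma restr_id B : restr B (dom B) = B.
Proof.
by apply/esym/substr_restr; split=> // R t; split=> [tB|[]//]; split=> //; apply: rel_dom.
Qed.

Lemma capstr_restr B S T : capstr (restr B S) (restr B T) = restr B (S `&` T).
Proof.
apply: structure_ext => [|R t].
  by rewrite /= fsetIACA fsetIid.
rewrite in_fsetI !mem_restr andbACA andbb -all_predI; congr (_ && _).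
by apply: eq_all => x /=; rewrite inE.
Qed.

Lemma restr_sub B S T : S `<=` T -> restr (restr B T) S = restr B S.
Proof. by move=> ST; rewrite restr_restr (fsetIidPr ST). Qed.

Lemma restr_domE B S : S `<=` dom B -> dom (restr B S) = S.
Proof. by move=> SB; apply/fsetIidPr. Qed.

Lemma qsat_isom f A B n (e : n.-tuple U) q : isom f A B -> {subset e <= dom A} ->
  qsat A e q <-> qsat B [tuple of map f e] q.
Proof.
move=> [finj _ frel] eA.
elim: q => [[i j|R v]|q [? ?]|q [? ?] r [? ?]|q [? ?] r [? ?]] /=; try tauto.
  rewrite !tnth_map; split=> [->//|]; apply: finj; exact/eA/mem_tnth.
rewrite frel => [|_ /mapP[i _ ->]]; last exact/eA/mem_tnth.
suff -> : [tuple of map f [tuple of map (tnth e) v]] =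
          [tuple of map (tnth [tuple of map f e]) v] by [].
by apply: eq_from_tnth => i; rewrite !tnth_map.
Qed.

Lemma usat_isom f A B n (p : @uformula L n) (e : n.-tuple U) :
  isom f A B -> {subset e <= dom A} ->
  usat A p e <-> usat B p [tuple of map f e].
Proof.
move=> fAB; elim: p e => [{}n q e eA|{}n p IH e eA] /=; first exact: qsat_isom.
have [_ fA _] := fAB.
have consE x : [tuple of map f [tuple of x :: e]] = [tuple of f x :: [tuple of map f e]].
  exact: val_inj.
have xeA x : x \in dom A -> {subset [tuple of x :: e] <= dom A}.
  by move=> xA y; rewrite inE => /orP[/eqP->|/eA].
split=> sat x.
  rewrite -fA => /imfsetP[y yA ->]; rewrite -consE.
  by apply/IH; [apply: xeA | apply: sat].
move=> xA; apply/IH; first exact: xeA.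
by rewrite consE; apply: sat; rewrite -fA; apply: in_imfset.
Qed.

Lemma isom_restr f A B S : S `<=` dom A -> isom f A B ->
  isom f (restr A S) (restr B (f @` S)).
Proof.
move=> SA [finj fA frel]; split.
- by move=> x y; rewrite !restr_domE // => /(fsubsetP SA) ? /(fsubsetP SA) ?; apply: finj.
- by rewrite !restr_domE // -fA; apply: subset_imfset; apply/fsubsetP.
move=> R t; rewrite restr_domE // => tS.
rewrite !mem_restr.
have -> : all (mem S) t by apply/allP.
have -> : all (mem (f @` S)) (map f t).
  by apply/allP => _ /mapP[x /tS xS ->]; apply: in_imfset.
by rewrite !andbT; apply: frel => x /tS /(fsubsetP SA).
Qed.

(** * Closed sets of a 1-local smooth class *)

Section Smooth.
Variables (K : structure L U -> Prop) (le : structure L U -> structure L U -> Prop).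
Hypotheses (smoothK : smooth_class K le) (localK : one_local K le).

Lemma class_restr B S : K B -> K (restr B S).
Proof. by case: localK => Ksub _ _ KB; apply: (Ksub _ B) => //; apply: restr_substr. Qed.

(** Being [<=] is expressed by universal formulas that depend only on the
    isomorphism type of the smaller structure, and satisfaction is invariant
    under isomorphism. *)
Lemma le_isom f A B S : K A -> isom f A B -> S `<=` dom A ->
  le (restr A S) A <-> le (restr B (f @` S)) B.
Proof.
move=> KA fAB SA; have KB := smooth_isom smoothK fAB KA.
have [Phi [PhiP Phi_isom]] := smooth_universal smoothK.
have fS := isom_restr SA fAB.
pose b := in_tuple (enum_fset S).
have bS : b =i S by [].
have enum_b : enumerates b (restr A S).
  by split=> [|x]; rewrite ?fset_uniq // restr_domE // bS.
have [finj fA _] := fAB.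
have fSB : f @` S `<=` dom B by rewrite -fA; apply: subset_imfset; apply/fsubsetP.
have enum_fb : enumerates [tuple of map f b] (restr B (f @` S)).
  split=> [|x]; last first.
    rewrite restr_domE //; apply/mapP/imfsetP => -[y yS ->]; exists y => //.
  rewrite map_inj_in_uniq ?fset_uniq // => x y; rewrite !bS.
  by move=> /(fsubsetP SA) xA /(fsubsetP SA) yA; apply: finj.
have [_ ->] := PhiP _ _ _ (class_restr S KA) enum_b;
  try exact: restr_substr; last by [].
have [_ ->] := PhiP _ _ _ (class_restr (f @` S) KB) enum_fb;
  try exact: restr_substr; last by [].
have PhiE := Phi_isom f _ _ _ _ (class_restr S KA) (class_restr (f @` S) KB) fS enum_b.
have satE p : usat A p b <-> usat B p [tuple of map f b].
  by apply: usat_isom => // x; rewrite bS => /(fsubsetP SA).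
by split=> sat p Pp; [apply/satE/sat/PhiE | apply/satE/sat/PhiE].
Qed.

Hypothesis fapK : fAP K le.

(** Amalgamating [A] with the empty structure over the empty structure gives
    back [A]. *)
Lemma le_refl A : K A -> le A A.
Proof.
move=> KA; have [E [E0 [KE leE]]] := smooth_empty smoothK.
have domE : dom A `&` dom E = dom E by rewrite E0 fsetI0.
have [_ + _] := fapK (leE _ KA) (leE _ KE) domE.
suff -> : free_amalgam A E = A by [].
have [_ rE] := smooth_substr smoothK (leE _ KA).
apply: structure_ext => [|R t] /=; first by rewrite E0 fsetU0.
by rewrite in_fsetU; apply/orP/idP => [|tA]; [case=> [|/rE[]] | left].
Qed.

Definition closed A S : Prop := S `<=` dom A /\ le (restr A S) A.

Lemma closed_empty A : K A -> closed A fset0.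
Proof.
move=> KA; split; first exact: fsub0set.
have [E [E0 [KE leE]]] := smooth_empty smoothK.
by rewrite -E0 -(substr_restr (smooth_substr smoothK (leE A KA))); apply: leE.
Qed.

Lemma closed_dom A : K A -> closed A (dom A).
Proof. by move=> KA; split=> //; rewrite restr_id; apply: le_refl. Qed.

(** Smooth intersections, applied to [S] in [A] and to the substructure on [T]. *)
Lemma closed_restrI A S T : K A -> T `<=` dom A -> closed A S ->
  closed (restr A T) (S `&` T).
Proof.
move=> KA TA [SA leS]; have [_ smoothI _] := localK.
split; first by rewrite restr_domE // fsubsetIr.
rewrite restr_sub ?fsubsetIr // -capstr_restr.
have capT : capstr A (restr A T) = restr A T.
  by rewrite -{1}[A]restr_id capstr_restr (fsetIidPr TA).
rewrite -{2}capT; apply: smoothI => //; try exact: class_restr.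
exists A; split; try exact: restr_substr.
by rewrite -{1}[A]restr_id; apply: restr_substr.
Qed.

Lemma closed_trans A S T : S `<=` T ->
  closed (restr A T) S -> closed A T -> closed A S.
Proof.
move=> ST [_ leST] [TA leTA]; split; first exact: fsubset_trans TA.
by rewrite -(restr_sub A ST); apply: smooth_trans smoothK _ _ _ leST leTA.
Qed.

Lemma closedI A S T : K A -> closed A S -> closed A T -> closed A (S `&` T).
Proof.
move=> KA clS clT; apply: (closed_trans (T := T)) => //; first exact: fsubsetIr.
by apply: closed_restrI => //; case: clT.
Qed.

Lemma closedU A S T : K A -> closed A S -> closed A T -> closed A (S `|` T).
Proof.
move=> KA [SA leS] [TA leT]; have [_ _ unionK] := localK.
split; first by rewrite fsubUset SA.
rewrite -[in restr A (S `|` T)](restr_domE SA) -[in restr A (_ `|` T)](restr_domE TA).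
by apply: unionK => //; try exact: class_restr; apply: restr_substr.
Qed.

Lemma closed_isom f A B S : K A -> isom f A B -> S `<=` dom A ->
  closed A S <-> closed B (f @` S).
Proof.
move=> KA fAB SA; have leE := le_isom KA fAB SA.
have [_ fA _] := fAB.
split=> [[_ /leE leB]|[_ /leE leA]]; split=> //.
by rewrite -fA; apply: subset_imfset; apply/fsubsetP.
Qed.

(** A closed set containing [x] of minimal size is the least one, since closed
    sets are stable under intersection. *)
Lemma least_closed A x : K A -> x \in dom A ->
  exists S, [/\ closed A S, x \in S & forall T, closed A T -> x \in T -> S `<=` T].
Proof.
move=> KA xA.
suff: forall n S, closed A S -> x \in S -> #|` S| <= n ->
    exists S, [/\ closed A S, x \in S & forall T, closed A T -> x \in T -> S `<=` T].
  by move/(_ _ _ (closed_dom KA) xA (leqnn _)).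
elim=> [|n IH] S clS xS.
  by rewrite leqn0 cardfs_eq0 => /eqP S0; rewrite S0 in xS.
move=> Sn; have [least|] := pselect (forall T, closed A T -> x \in T -> S `<=` T).
  by exists S.
move=> /existsNP[T /not_implyP[clT /not_implyP[xT /negP SNT]]].
apply: (IH (S `&` T)); first exact: closedI.
  by rewrite inE xS.
rewrite -ltnS; apply: leq_trans Sn; apply: fproper_ltn_card.
by rewrite fproperE fsubsetIl fsubsetI fsubset_refl.
Qed.

Definition closure A x : {fset U} :=
  [fset y in dom A | `[< forall T, closed A T -> x \in T -> y \in T >]].

Lemma closureP A x : K A -> x \in dom A ->
  [/\ closed A (closure A x), x \in closure A x &
      forall T, closed A T -> x \in T -> closure A x `<=` T].
Proof.
move=> KA xA; have [S [clS xS Smin]] := least_closed KA xA.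
have -> : closure A x = S; last by [].
apply/fsetP => y; rewrite !inE; apply/andP/idP => [[_ /asboolP]|yS]; first exact.
split; first by apply: (fsubsetP clS.1).
by apply/asboolP => T clT xT; apply: (fsubsetP (Smin T clT xT)).
Qed.

(** Such a set is the union of the closures of its points, so that 1-locality
    applies. *)
Lemma closed_bigU A S : K A -> S `<=` dom A ->
  (forall x, x \in S -> closure A x `<=` S) -> closed A S.
Proof.
move=> KA SA clS.
have -> : S = \bigcup_(x <- enum_fset S) closure A x.
  apply/fsetP => y; apply/idP/bigfcupP => [yS|[x /andP[xS _] /(fsubsetP (clS x xS))]] //.
  exists y; first by rewrite yS.
  by have [_ ? _] := closureP KA (fsubsetP SA y yS).
rewrite big_seq; apply: big_ind => [|? ?|x xS]; first exact: closed_empty.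
  exact: closedU.
by have [] := closureP KA (fsubsetP SA x xS).
Qed.

(** For subsets of a closed set [S], being closed in [A] is the same as being
    closed in the substructure on [S], which is transported by [f]. *)
Lemma closure_isom f A S T : K A -> closed A S -> closed A T ->
  isom f (restr A S) (restr A T) -> forall x, x \in S ->
  closure A (f x) = f @` closure A x.
Proof.
move=> KA clS clT fST x xS.
have [SA TA] := (clS.1, clT.1).
have sub_cl R R' : R' `<=` R -> closed A R -> closed A R' <-> closed (restr A R) R'.
  move=> RR' clR; split=> [clR'|clR']; last exact: closed_trans clR.
  by rewrite -(fsetIidPl RR'); apply: closed_restrI => //; case: clR.
have xA := fsubsetP SA x xS.
have [cl_x x_cl x_min] := closureP KA xA.
have xsubS : closure A x `<=` S by apply: x_min.
have KS := class_restr S KA.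
have [finj fS _] := fST; rewrite !restr_domE // in finj fS.
have fxT : f x \in T by rewrite -fS; apply: in_imfset.
have [cl_fx fx_cl fx_min] := closureP KA (fsubsetP TA _ fxT).
have fsubT R : R `<=` S -> f @` R `<=` T.
  by move=> RS; rewrite -fS; apply: subset_imfset; apply/fsubsetP.
have clE R : R `<=` S -> closed A R <-> closed A (f @` R).
  move=> RS; rewrite (sub_cl _ _ RS clS) (sub_cl _ _ (fsubT _ RS) clT).
  by apply: closed_isom => //; rewrite restr_domE.
apply/eqP; rewrite eqEfsubset; apply/andP; split.
  by apply: fx_min; [apply: (clE _ xsubS).1 | apply: in_imfset].
have clTx : closure A (f x) `<=` T by apply: fx_min.
pose R := [fset y in S | f y \in closure A (f x)].
have fR : f @` R = closure A (f x).
  apply/fsetP => z; apply/imfsetP/idP => [[y /[!inE]/andP[_ ?] ->] //|zcl].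
  have := fsubsetP clTx z zcl; rewrite -{1}fS => /imfsetP[y yS zE].
  by rewrite zE in zcl; exists y => //; rewrite /R !inE yS; rewrite !inE in zcl.
have RS : R `<=` S by apply/fsubsetP => y; rewrite !inE => /andP[].
rewrite -fR; apply: subset_imfset; apply/fsubsetP/x_min; last first.
  by rewrite /R !inE xS; rewrite !inE in fx_cl.
by apply: (clE _ RS).2; rewrite fR.
Qed.
End Smooth.
End Structures.

(** * The union of the copies *)

Section Copies.
Context {L : language} {U : choiceType}.
Variables (K : structure L U -> Prop) (le : structure L U -> structure L U -> Prop).
Hypotheses (smoothK : smooth_class K le) (localK : one_local K le) (fapK : fAP K le).
Variables (A : structure L U) (gT : finGroupType) (G : {group gT}) (act : gT -> U -> U).
Hypothesis KA : K A.
Hypothesis act1 : forall u, act 1%g u = u.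
Hypothesis actM : forall g h u, act (g * h)%g u = act h (act g u).
Local Notation cl := (closure le A).
Hypothesis act_closure : forall g x y, g \in G -> x \in dom A -> act g x \in dom A ->
  y \in cl x -> act g y \in cl (act g x).
Hypothesis act_rel : forall g (R : symbol L) (t : (arity R).-tuple U), g \in G ->
  {subset t <= dom A} -> {subset map (act g) t <= dom A} ->
  t \in rel A R <-> [tuple of map (act g) t] \in rel A R.
Hypothesis act_conformal : forall M : {fset U},
  {in M &, forall u v, exists g, [/\ g \in G, act g u \in dom A & act g v \in dom A]} ->
  (forall g x y, g \in G -> x \in dom A -> act g x \in M -> y \in cl x -> act g y \in M) ->
  exists2 g, g \in G & forall u, u \in M -> act g u \in dom A.
Implicit Types (M N : {fset U}) (u v : U).

Lemma actK g : cancel (act g) (act g^-1%g).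
Proof. by move=> u; rewrite -actM mulgV act1. Qed.

Lemma actVK g : cancel (act g^-1%g) (act g).
Proof. by move=> u; rewrite -actM mulVg act1. Qed.

Definition copies_dom : {fset U} := \bigcup_(g in G) (act g @` dom A).
Definition copies_rel (R : symbol L) : {fset (arity R).-tuple U} :=
  \bigcup_(g in G) ((fun t : (arity R).-tuple U => [tuple of map (act g) t]) @` rel A R).

Lemma copies_domP u :
  u \in copies_dom <-> exists g x, [/\ g \in G, x \in dom A & u = act g x].
Proof.
split=> [/bigfcupP[g /andP[_ gG] /imfsetP[x xA ->]]|[g [x [gG xA ->]]]].
  by exists g, x.
by apply/bigfcupP; exists g; [rewrite mem_index_enum | apply: in_imfset].
Qed.

Lemma copies_relP (R : symbol L) (t : (arity R).-tuple U) :
  t \in copies_rel R <->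
  exists g t0, [/\ g \in G, t0 \in rel A R & t = [tuple of map (act g) t0]].
Proof.
split=> [/bigfcupP[g /andP[_ gG] /imfsetP[t0 tA ->]]|[g [t0 [gG tA ->]]]].
  by exists g, t0.
apply/bigfcupP; exists g; first by rewrite mem_index_enum.
by apply/imfsetP; exists t0.
Qed.

Lemma copies_rel_dom (R : symbol L) (t : (arity R).-tuple U) :
  t \in copies_rel R -> {subset t <= copies_dom}.
Proof.
move=> /copies_relP[g [t0 [gG t0A ->]]] _ /mapP[x xt ->].
by apply/copies_domP; exists g, x; split=> //; apply: rel_dom xt.
Qed.

Definition copies : structure L U := Structure copies_rel_dom.

Lemma copies_isom g : g \in G -> isom (act g) copies copies.
Proof.
move=> gG; have sub h u : h \in G -> u \in copies_dom -> act h u \in copies_dom.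
  move=> hG /copies_domP[k [x [kG xA ->]]]; apply/copies_domP.
  by exists (k * h)%g, x; rewrite groupM // actM.
have subr h (R : symbol L) (t : (arity R).-tuple U) : h \in G ->
    t \in copies_rel R -> [tuple of map (act h) t] \in copies_rel R.
  move=> hG /copies_relP[k [t0 [kG t0A ->]]]; apply/copies_relP.
  exists (k * h)%g, t0; rewrite groupM //; split=> //; apply: val_inj => /=.
  by rewrite -map_comp; apply: eq_map => u /=; rewrite actM.
split=> [u v _ _|/=|R t _]; first exact: (can_inj (actK g)).
  apply/fsetP => u; apply/imfsetP/idP => [[v vB ->]|uB]; first exact: sub.
  by exists (act g^-1%g u); rewrite ?actVK //; apply: sub; rewrite ?groupV.
split=> [|/(subr _ _ _ (groupVr gG))]; first exact: subr.
suff -> : [tuple of map (act g^-1%g) [tuple of map (act g) t]] = t by [].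
apply: val_inj; rewrite /= -map_comp -[RHS]map_id.
by apply: eq_map => u /=; rewrite actK.
Qed.

(** The copies carry no more relations on [A] than [A] itself: a tuple of [A]
    that comes from another copy is moved within [A] by a group element. *)
Lemma copies_rel_act g (R : symbol L) (t : (arity R).-tuple U) :
  g \in G -> {subset t <= dom A} ->
  t \in rel A R <-> [tuple of map (act g) t] \in rel copies R.
Proof.
move=> gG tA; split=> [tR|/copies_relP[h [t0 [hG t0R /(congr1 val)/= tE]]]].
  by apply/copies_relP; exists g, t.
have tE' : tval t = map (act (h * g^-1)%g) t0.
  rewrite -[LHS]map_id (eq_map (g := act g^-1%g \o act g)) => [|u /=]; last first.
    by rewrite actK.
  by rewrite map_comp tE -map_comp; apply: eq_map => u /=; rewrite actM.
have -> : t = [tuple of map (act (h * g^-1)%g) t0] by apply: val_inj.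
have kG : (h * g^-1)%g \in G by rewrite groupM ?groupV.
by apply: (act_rel kG (rel_dom t0R) _).1 => //; rewrite -tE'.
Qed.

Lemma substr_copies : substr A copies.
Proof.
split=> [|R t].
  by apply/fsubsetP => x xA; apply/copies_domP; exists 1%g, x; rewrite act1.
have t1 : [tuple of map (act 1%g) t] = t.
  by apply: val_inj; rewrite /= -[RHS]map_id; apply: eq_map => u; rewrite act1.
split=> [tR|[tR tA]].
  have tA := rel_dom tR; split=> //.
  by rewrite -t1; apply/(copies_rel_act (group1 G) tA).
by apply/(copies_rel_act (group1 G) tA); rewrite t1.
Qed.

Lemma copy_isom g : g \in G ->
  isom (act g) A (restr copies (act g @` dom A)).
Proof.
move=> gG; have subB : act g @` dom A `<=` copies_dom.
  by apply/fsubsetP => _ /imfsetP[x xA ->]; apply/copies_domP; exists g, x.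
split=> [u v _ _||R t tA]; first exact: (can_inj (actK g)).
  by rewrite restr_domE.
rewrite (copies_rel_act gG tA) mem_restr.
have -> : all (mem (act g @` dom A)) (map (act g) t).
  by apply/allP => _ /mapP[x /tA xA ->]; apply: in_imfset.
by rewrite andbT.
Qed.

(** Stability under the closures transported from [A]. *)
Definition copies_closed M : Prop := M `<=` copies_dom /\
  forall g x y, g \in G -> x \in dom A -> act g x \in M -> y \in cl x -> act g y \in M.

Lemma copies_closedI M N : copies_closed M -> copies_closed N -> copies_closed (M `&` N).
Proof.
move=> [MB clM] [_ clN]; split; first exact: fsubset_trans (fsubsetIl _ _) MB.
move=> g x y gG xA; rewrite !in_fsetI => /andP[xM xN] ycl.
by apply/andP; split; [apply: (clM g x) | apply: (clN g x)].
Qed.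

(** [u] lies in the closure of [v], computed in some copy of [A] through [v]. *)
Definition below u v : Prop :=
  exists g x, [/\ g \in G, x \in dom A, v = act g x & act g^-1%g u \in cl x].

Lemma cl_sub x : x \in dom A -> {subset cl x <= dom A}.
Proof.
by move=> xA; have [[/fsubsetP clA _] _ _] := closureP smoothK localK fapK KA xA.
Qed.

Lemma cl_refl x : x \in dom A -> x \in cl x.
Proof. by move=> xA; have [_ ? _] := closureP smoothK localK fapK KA xA. Qed.

Lemma cl_trans x y : x \in dom A -> y \in cl x -> cl y `<=` cl x.
Proof.
move=> xA ycl; have [_ _] := closureP smoothK localK fapK KA (cl_sub xA ycl); apply=> //.
by have [] := closureP smoothK localK fapK KA xA.
Qed.

(** The choice of the copy does not matter. *)
Lemma belowE g x u : g \in G -> x \in dom A ->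
  below u (act g x) <-> act g^-1%g u \in cl x.
Proof.
move=> gG xA; split=> [[h [x' [hG x'A xE ucl]]]|ucl]; last by exists g, x.
have x'E : act (h * g^-1)%g x' = x by rewrite actM -xE actK.
have -> : act g^-1%g u = act (h * g^-1)%g (act h^-1%g u) by rewrite actM actVK.
by rewrite -x'E; apply: act_closure; rewrite ?groupM ?groupV ?x'E.
Qed.

Definition avoid u M : {fset U} := [fset v in M | ~~ `[< below u v >]].

Lemma mem_avoid u M v : v \in avoid u M <-> v \in M /\ ~ below u v.
Proof.
rewrite !inE; split=> [/andP[? /asboolPn]|[? ?]] //.
by apply/andP; split=> //; apply/asboolPn.
Qed.

Lemma avoid_sub u M : avoid u M `<=` M.
Proof. by apply/fsubsetP => v /mem_avoid[]. Qed.

Lemma avoid_closed u M : copies_closed M -> copies_closed (avoid u M).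
Proof.
move=> [MB clM]; split; first exact: fsubset_trans (avoid_sub u M) MB.
move=> g x y gG xA /mem_avoid[xM ux] ycl; apply/mem_avoid; split; first exact: (clM g x).
move=> /(belowE _ gG (cl_sub xA ycl)) uy; apply: ux; apply/belowE => //.
exact: (fsubsetP (cl_trans xA ycl)).
Qed.

Lemma avoid_proper u M : M `<=` copies_dom -> u \in M -> (#|` avoid u M| < #|` M|)%N.
Proof.
move=> MB uM; apply: fproper_ltn_card; rewrite fproperE avoid_sub /=.
apply/negP => /fsubsetP/(_ u uM)/mem_avoid[_]; apply.
have /copies_domP[g [x [gG xA uE]]] := fsubsetP MB u uM.
by rewrite {2}uE; apply/belowE; rewrite // uE actK; apply: cl_refl.
Qed.

(** A point of [M] with [u] and [v] in its closure would put them in a common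
    copy, and so would a tuple of related points of [M] with [u] in the closure
    of one entry and [v] in the closure of another. *)
Lemma avoid_amalgam u v M : M `<=` copies_dom ->
  (forall g, g \in G -> act g u \in dom A -> act g v \in dom A -> False) ->
  restr copies M = free_amalgam (restr copies (avoid u M)) (restr copies (avoid v M)).
Proof.
move=> MB unlinked.
have uB w : avoid w M `<=` copies_dom := fsubset_trans (avoid_sub w M) MB.
have notboth g x x' : g \in G -> x \in dom A -> x' \in dom A ->
    below u (act g x) -> below v (act g x') -> False.
  move=> gG xA x'A /(belowE _ gG xA)/(cl_sub xA) gu /(belowE _ gG x'A)/(cl_sub x'A) gv.
  by apply: (unlinked g^-1%g); rewrite ?groupV.
apply: structure_ext => [|R t].
  rewrite /= !(fsetIidPr _) //; apply/fsetP => z; apply/idP/fsetUP => [zM|[]]; last first.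
  - by case/mem_avoid.
  - by case/mem_avoid.
  have [uz|uz] := pselect (below u z); [right|left]; apply/mem_avoid; split=> //.
  have /copies_domP[g [x [gG xA zE]]] := fsubsetP MB z zM.
  by rewrite zE in uz * => vz; apply: notboth uz vz.
rewrite in_fsetU !mem_restr -andb_orr; apply/andP/andP => -[tB]; last first.
  by move=> /orP[] /allP tM; split=> //; apply/allP => z /tM /mem_avoid[].
move=> /allP tM; split=> //.
have [_ //|/allPn[z zt zu]] := boolP (all (mem (avoid u M)) t).
have [_|/allPn[z' z't z'v]] := boolP (all (mem (avoid v M)) t); first by rewrite orbT.
have bu : below u z.
  by apply: contrapT => uz; case/negP: zu; apply/mem_avoid; split=> //; apply: tM.
have bv : below v z'.
  by apply: contrapT => vz; case/negP: z'v; apply/mem_avoid; split=> //; apply: tM.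
have /copies_relP[g [t0 [gG t0R tE]]] := tB.
move: zt z't bu bv; rewrite tE => /mapP[x xt ->] /mapP[x' x't ->] bu bv.
by case: (notboth g x x'); rewrite ?(rel_dom t0R).
Qed.

(** Induction on the size of [M].  In the linked case everything is pulled back
    to [A]; in the other case [M] is a free amalgam of two smaller stable sets,
    and a stable subset of [M] is the union of its traces on the two parts. *)
Lemma copies_closed_le M : copies_closed M ->
  K (restr copies M) /\
  forall N, N `<=` M -> copies_closed N -> closed le (restr copies M) N.
Proof.
have [n] := ubnP #|` M|; elim: n M => // n IH M; rewrite ltnS => Mn clM.
have [MB clM'] := clM.
have [linked|] := pselect {in M &, forall u v, exists g,
    [/\ g \in G, act g u \in dom A & act g v \in dom A]}.
  have [h hG hM] := act_conformal linked clM'.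
  pose g := (h^-1)%g; have gG : g \in G by rewrite groupV.
  have pull N : N `<=` M -> copies_closed N ->
      [/\ act h @` N `<=` dom A, act g @` (act h @` N) = N & closed le A (act h @` N)].
    move=> NM [_ clN].
    have NA : act h @` N `<=` dom A.
      by apply/fsubsetP => _ /imfsetP[z /(fsubsetP NM) zM ->]; apply: hM.
    have gN : act g @` (act h @` N) = N.
      apply/fsetP => z; apply/imfsetP/idP => [[_ /imfsetP[y yN ->] ->]|zN].
        by rewrite actK.
      by exists (act h z); rewrite ?actK //; apply: in_imfset.
    split=> //; apply: (closed_bigU smoothK localK fapK KA) => // _ /imfsetP[z zN ->].
    apply/fsubsetP => y ycl; apply/imfsetP; exists (act g y); last by rewrite actVK.
    by apply: (clN g (act h z)); rewrite ?actK //; apply/hM/(fsubsetP NM).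
  have [MA gM clMA] := pull M (fsubset_refl _) clM.
  have isoM : isom (act g) (restr A (act h @` M)) (restr copies M).
    have := isom_restr MA (copy_isom gG); rewrite gM restr_sub //.
    by rewrite -gM; apply: subset_imfset; apply/fsubsetP.
  split; first exact: (smooth_isom smoothK isoM (class_restr localK _ KA)).
  move=> N NM clN; have [NA gN clNA] := pull N NM clN.
  have NM' : act h @` N `<=` act h @` M by apply: subset_imfset; apply/fsubsetP.
  have NM'' : act h @` N `<=` dom (restr A (act h @` M)) by rewrite restr_domE.
  rewrite -gN; apply: (closed_isom smoothK localK (class_restr localK _ KA) isoM NM'').1.
  by rewrite -(fsetIidPl NM'); apply: (closed_restrI localK).
move=> /existsNP[u /existsNP[v /not_implyP[uM /not_implyP[vM unlinked]]]].
have unlinked' g : g \in G -> act g u \in dom A -> act g v \in dom A -> False.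
  by move=> gG gu gv; apply: unlinked; exists g.
have clu : copies_closed (avoid u M) by apply: avoid_closed.
have clv : copies_closed (avoid v M) by apply: avoid_closed.
have [Ku leu] := IH _ (leq_trans (avoid_proper MB uM) Mn) clu.
have [Kv lev] := IH _ (leq_trans (avoid_proper MB vM) Mn) clv.
have subB w : avoid w M `<=` copies_dom := fsubset_trans (avoid_sub w M) MB.
pose W := avoid u M `&` avoid v M.
have Wu : W `<=` avoid u M := fsubsetIl _ _.
have Wv : W `<=` avoid v M := fsubsetIr _ _.
have clW : copies_closed W by apply: copies_closedI.
have [_ leWu] := leu W Wu clW; have [_ leWv] := lev W Wv clW.
rewrite !restr_sub // in leWu leWv.
have domW : dom (restr copies (avoid u M)) `&` dom (restr copies (avoid v M))
            = dom (restr copies W).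
  by rewrite !restr_domE //; apply: fsubset_trans Wu _.
have := fapK leWu leWv domW; rewrite -avoid_amalgam // => -[KM leuM levM].
split=> // N NM clN.
have part w : w = u \/ w = v -> closed le (restr copies M) (N `&` avoid w M).
  move=> wuv; have NwS := fsubsetIr N (avoid w M).
  apply: (closed_trans smoothK NwS).
    rewrite restr_sub ?avoid_sub //.
    case: wuv NwS => -> NwS; [apply: leu | apply: lev] => //; exact: copies_closedI.
  split; first by rewrite restr_domE // avoid_sub.
  by rewrite restr_sub ?avoid_sub //; case: wuv => ->.
have -> : N = (N `&` avoid u M) `|` (N `&` avoid v M).
  rewrite -fsetIUr; apply/esym/fsetIidPl; apply: fsubset_trans NM _.
  have := congr1 (@dom L U) (avoid_amalgam MB unlinked').
  by rewrite /= !(fsetIidPr _) // => <-.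
by apply: (closedU localK) => //; apply: part; [left|right].
Qed.

Lemma copies_class : K copies /\ le A copies.
Proof.
have cldom : copies_closed copies_dom.
  split=> // g x y gG xA _ /(cl_sub xA) yA.
  by apply/copies_domP; exists g, y.
have [KB leB] := copies_closed_le cldom.
rewrite -[copies_dom]/(dom copies) restr_id in KB leB.
split=> //; rewrite [in le A _](substr_restr substr_copies).
have [] // := leB (dom A); first by case: substr_copies.
split; first by case: substr_copies.
by move=> g x y gG xA gxA ycl; apply: (cl_sub gxA); apply: act_closure.
Qed.
End Copies.

Theorem proposition3p21 (L : language) (U : choiceType)
    (infU : infinite_ambient U)
    (K : structure L U -> Prop) (le : structure L U -> structure L U -> Prop)
    (smoothK : smooth_class K le) (localK : one_local K le) (fapK : fAP K le) :
  le_EPPA K le.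
Proof.
move=> A n f D E KA partial.
pose cl (x : dom A) : {set dom A} := [set y | fsval y \in closure le A (fsval x)].
pose Q (R : symbol L) (t : seq (dom A)) :=
  exists2 r : (arity R).-tuple U, r \in rel A R & map (@fsval _ _) t = r.
have mem_cl (x y : dom A) : (y \in cl x) = (fsval y \in closure le A (fsval x)).
  by rewrite in_set.
have cltr (x y : dom A) : y \in cl x -> cl y \subset cl x.
  rewrite mem_cl => ycl; apply/subsetP => z; rewrite !mem_cl.
  by apply: (fsubsetP (cl_trans smoothK localK fapK KA _ ycl)).
have [gT [G [act cover]]] := ambient_closure_cover Q infU cltr.
have act1 := cover_act1 cover; have actM := cover_actM cover.
have act_cl g x y : g \in G -> x \in dom A -> act g x \in dom A ->
    y \in closure le A x -> act g y \in closure le A (act g x).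
  move=> gG xA gxA ycl; have yA := cl_sub smoothK localK fapK KA xA ycl.
  have ycl' : [` yA] \in cl [` xA] by rewrite mem_cl.
  have [y' y'cl ->] := @cover_cl _ _ _ _ _ _ _ _ _ cover g [` xA] [` gxA] _ gG erefl ycl'.
  by rewrite mem_cl in y'cl.
have lift (s : seq U) : {subset s <= dom A} ->
    exists s' : seq (dom A), map (@fsval _ _) s' = s.
  elim: s => [|x s IH] sA; first by exists [::].
  have [s' s'E] : exists s' : seq (dom A), map (@fsval _ _) s' = s.
    by apply: IH => y ys; apply: sA; rewrite inE ys orbT.
  by exists ([` sA x (mem_head x s)] :: s'); rewrite /= s'E.
have QE (R : symbol L) (r : (arity R).-tuple U) t :
    map (@fsval _ _) t = r -> Q R t <-> r \in rel A R.
  move=> tr; split=> [[r' r'A]|rA]; last by exists r.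
  by rewrite tr => /val_inj->.
have act_rl g (R : symbol L) (t : (arity R).-tuple U) : g \in G ->
    {subset t <= dom A} -> {subset map (act g) t <= dom A} ->
    t \in rel A R <-> [tuple of map (act g) t] \in rel A R.
  move=> gG /lift[s sE] /lift[s' s'E].
  rewrite -(QE _ _ _ sE) -(QE R [tuple of map (act g) t] s') //.
  apply: (@cover_rel _ _ _ _ _ _ _ _ _ cover g R s s' gG).
  by rewrite s'E -sE -map_comp.
have act_conf (M : {fset U}) :
    {in M &, forall u v, exists g, [/\ g \in G, act g u \in dom A & act g v \in dom A]} ->
    (forall g x y, g \in G -> x \in dom A -> act g x \in M ->
       y \in closure le A x -> act g y \in M) ->
    exists2 g, g \in G & forall u, u \in M -> act g u \in dom A.
  move=> linked clM.
  have [||g gG gM] := cover_conformal cover (M := fun u => u \in M).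
  - move=> u v uM vM; have [g [gG gu gv]] := linked u v uM vM.
    by exists g, [` gu], [` gv].
  - move=> g x y gG xM; rewrite mem_cl; exact: clM.
  by exists g => // u /gM[x ->].
have [KB leB] := copies_class smoothK localK fapK KA act1 actM act_cl act_rl act_conf.
exists (copies A G act); split=> //.
suff /choice[g gP] : forall i, exists g, g \in G /\ {in dom (D i), f i =1 act g}.
  exists (fun i => act (g i)) => i; have [gG gf] := gP i.
  by split=> //; apply: copies_isom.
move=> i; have [DA EA fDE leD leE] := partial i.
have [DAsub EAsub] := (DA.1, EA.1).
have [finj fD frel] := fDE.
have fE x : x \in dom (D i) -> f i x \in dom A.
  by move=> xD; apply: (fsubsetP EAsub); rewrite -fD; apply: in_imfset.
have DE := substr_restr DA; have EE := substr_restr EA.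
have clD : closed le A (dom (D i)) by split; rewrite -?DE.
have clE : closed le A (dom (E i)) by split; rewrite -?EE.
have fiso : isom (f i) (restr A (dom (D i))) (restr A (dom (E i))) by rewrite -DE -EE.
have clf := closure_isom smoothK localK fapK KA clD clE fiso.
(* [f i] as a map on the points of [A]; outside [D i] its value is arbitrary. *)
pose f' (x : dom A) : dom A := insubd x (f i (fsval x)).
have f'E (x : dom A) : fsval x \in dom (D i) -> fsval (f' x) = f i (fsval x).
  by move=> xD; rewrite /f' val_insubd fE.
pose D' : {set dom A} := [set x | fsval x \in dom (D i)].
have clsubD x : x \in dom (D i) -> closure le A x `<=` dom (D i).
  move=> xD; have [_ _] := closureP smoothK localK fapK KA (fsubsetP DAsub x xD).
  exact.
have [|||g gG gf] := @cover_extend _ _ _ _ _ _ _ _ _ cover D' f'.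
- move=> x y; rewrite !in_set => xD yD /(congr1 (@fsval _ _)).
  by rewrite !f'E // => /(finj _ _ xD yD)/val_inj.
- move=> x; rewrite in_set => xD; split.
    apply/subsetP => y; rewrite mem_cl in_set; exact/fsubsetP/clsubD.
  apply/setP => y; rewrite mem_cl f'E // clf //.
  apply/imsetP/imfsetP => -[z].
    rewrite mem_cl => zcl ->; exists (fsval z) => //.
    by rewrite f'E //; apply: (fsubsetP (clsubD _ xD)).
  move=> zcl yE; have zD := fsubsetP (clsubD _ xD) z zcl.
  exists [` fsubsetP DAsub z zD]; first by rewrite mem_cl.
  by apply: val_inj; apply: etrans yE (esym (f'E [` fsubsetP DAsub z zD] zD)).
- move=> R t tD.
  have tD' : {subset map (@fsval _ _) t <= dom (D i)}.
    by move=> _ /mapP[x /tD + ->]; rewrite in_set.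
  have mapE : map (@fsval _ _) (map f' t) = map (f i) (map (@fsval _ _) t).
    by rewrite -!map_comp; apply/eq_in_map => x /tD; rewrite in_set => /f'E.
  have relE (r : (arity R).-tuple U) : map (@fsval _ _) t = r ->
      r \in rel A R <-> [tuple of map (f i) r] \in rel A R.
    move=> tr; rewrite tr in tD'; have := frel R r tD'.
    rewrite [in rel (D i) R]DE [in rel (E i) R]EE !mem_restr.
    have -> : all (mem (dom (D i))) r by apply/allP.
    have -> : all (mem (dom (E i))) (map (f i) r).
      by apply/allP => _ /mapP[x /tD' xD ->]; rewrite -[dom (E i)]fD; apply: in_imfset.
    by rewrite !andbT.
  split=> [[r rA]|[r rA tr]].
    rewrite mapE => rE; have szt : size (map (@fsval _ _) t) == arity R.
      by rewrite -(size_tuple r) -rE !size_map.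
    exists (Tuple szt) => //; apply/relE => //.
    by rewrite (_ : [tuple of _] = r) //; apply: val_inj.
  by exists [tuple of map (f i) r]; [apply: (relE r tr).1 | rewrite mapE tr].
exists g; split=> // x xD.
have xA := fsubsetP DAsub x xD.
have := gf [` xA]; rewrite in_set => /(_ xD) /= ->.
by rewrite f'E.
Qed.
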